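(* Let $g:\mathbb{R}^n\to\mathbb{R}\cup\{+\infty\}$ be a proper closed convex function and let $f=f_1-f_2$, where $f_1,f_2:\mathbb{R}^n\to\mathbb{R}$ are convex differentiable functions such that $\nabla f_1$ is Lipschitz continuous with modulus $L>0$, $\nabla f_2$ is Lipschitz continuous with modulus $l\ge 0$, and $L\ge l$. Let $F=f+g$, and assume $\inf F>-\infty$ and that this infimum is attained. Let $\mathcal X=\{x:0\in\nabla f(x)+\partial g(x)\}$ be the set of stationary points, and suppose: (a) (error bound) for any $\xi\ge\inf F$ there exist $\epsilon>0$ and $\tau>0$ such that $\operatorname{dist}(x,\mathcal X)\le\tau\|\mathrm{Prox}_{\frac1L g}(x-\tfrac1L\nabla f(x))-x\|$ whenever $\|\mathrm{Prox}_{\frac1L g}(x-\tfrac1L\nabla f(x))-x\|<\epsilon$ and $F(x)\le\xi$; (b) there exists $\delta>0$ such that $\|x-y\|\ge\delta$ whenever $x,y\in\mathcal X$ and $F(x)\ne F(y)$. Let $\{x^k\}$ be generated by Algorithm 1 (described in the context) with $\sup_k\beta_k<\sqrt{L/(L+l)}$. Then: (i) $\{x^k\}$ converges $R$-linearly to a stationary point of $F$ (a point of $\mathcal X$); (ii) the sequence $\{F(x^k)\}$ is $R$-linearly convergent.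
   Context: $\partial g$ denotes the convex subdifferential; $\operatorname{dist}(x,\mathcal X)=\inf_{y\in\mathcal X}\|x-y\|$. For a proper closed convex $h$, $\mathrm{Prox}_h(v)=\arg\min_{x\in\mathbb{R}^n}\{h(x)+\tfrac12\|x-v\|^2\}$. Algorithm 1 (proximal gradient algorithm with extrapolation): choose $x^0\in\operatorname{dom} g$ and $\{\beta_k\}\subseteq[0,\sqrt{L/(L+l)}]$, set $x^{-1}=x^0$, and for $k=0,1,2,\dots$ set $y^k=x^k+\beta_k(x^k-x^{k-1})$ and $x^{k+1}=\mathrm{Prox}_{\frac1L g}\big(y^k-\tfrac1L\nabla f(y^k)\big)$. A sequence $\{x^k\}$ converges $R$-linearly to $x^*$ if $\limsup_{k\to\infty}\|x^k-x^*\|^{1/k}<1$ (similarly for real sequences). *)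

(* Defs.v *)
From HB Require Import structures.
From mathcomp Require Import all_boot all_order all_algebra.
From mathcomp Require Import all_classical all_reals all_analysis.
Set Implicit Arguments. Unset Strict Implicit. Unset Printing Implicit Defensive.
Import Order.TTheory GRing.Theory Num.Theory.
Local Open Scope classical_set_scope.
Local Open Scope ring_scope.

Section Defs.
Variables (R : realType) (n : nat).
Notation vec := 'rV[R]_n.

Definition dotv (u v : vec) : R := \sum_(i < n) u 0 i * v 0 i.
Definition eucl_norm (u : vec) : R := Num.sqrt (dotv u u).

Definition convex_fun (f : vec -> R) : Prop :=
  forall x y (t : R), 0 <= t <= 1 ->
    f (t *: x + (1 - t) *: y) <= t * f x + (1 - t) * f y.

Definition is_gradient (f : vec -> R) (gf : vec -> vec) : Prop :=
  forall x (eps : R), 0 < eps -> exists2 del : R, 0 < del &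
    forall h, eucl_norm h < del ->
      `|f (x + h) - f x - dotv (gf x) h| <= eps * eucl_norm h.

Definition lipschitz_mod (G : vec -> vec) (c : R) : Prop :=
  forall x y, eucl_norm (G x - G y) <= c * eucl_norm (x - y).

Definition proper_fun (g : vec -> \bar R) : Prop :=
  (forall x, g x != -oo%E) /\ exists x, g x \is a fin_num.

(* convexity of an extended-valued function that never takes -oo:
   the convexity inequality on its effective domain *)
Definition convex_efun (g : vec -> \bar R) : Prop :=
  forall x y (t : R), 0 <= t <= 1 -> (g x < +oo)%E -> (g y < +oo)%E ->
    (g (t *: x + (1 - t) *: y)%R <= t%:E * g x + (1 - t)%:E * g y)%E.

Definition closed_fun (g : vec -> \bar R) : Prop :=
  forall x (a : R), (a%:E < g x)%E -> exists2 del : R, 0 < del &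
    forall y, eucl_norm (y - x) < del -> (a%:E < g y)%E.

Definition subgrad (g : vec -> \bar R) (x v : vec) : Prop :=
  g x \is a fin_num /\
  forall y, ((fine (g x) + dotv v (y - x))%:E <= g y)%E.

Definition is_prox (h : vec -> \bar R) (v p : vec) : Prop :=
  forall z, (h p + (eucl_norm (p - v) ^+ 2 / 2)%:E <= h z + (eucl_norm (z - v) ^+ 2 / 2)%:E)%E.

Definition scale_efun (c : R) (g : vec -> \bar R) : vec -> \bar R :=
  fun x => (c%:E * g x)%E.

(* dist(x, X) = inf_{y in X} ||x - y||  (= +oo when X is empty) *)
Definition dist_to (x : vec) (X : set vec) : \bar R :=
  ereal_inf [set (eucl_norm (x - y))%:E | y in X].

Definition Rlinear_vec (u : nat -> vec) (l : vec) : Prop :=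
  (limn_esup (fun k => (powR (eucl_norm (u k - l)) (k%:R^-1))%:E) < 1%:E)%E.

Definition Rlinear_real (a : nat -> R) (l : R) : Prop :=
  (limn_esup (fun k => (powR `|a k - l| (k%:R^-1))%:E) < 1%:E)%E.

End Defs.

(* Main.v *)
(* Write d_k = |x^k - x^(k-1)|. The descent inequality
     F(x^(k+1)) <= F(z) + (L+l)/2 |z - y^k|^2 - L/2 |z - x^(k+1)|^2
   at z = x^k shows that E_k = F(x^k) + L/2 d_k^2 drops by at least c d_k^2 with
   c > 0, so d_k -> 0. The residual at x^k is at most 3 d_k + d_(k+1), so by the
   error bound x^k stays within O(d_k + d_(k+1)) of stationary points w^k, which
   all share one value zeta for large k, by separation. The inequality at z = w^k
   then gives E_(k+2) - zeta <= A (E_k - E_(k+2)), hence geometric decay of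
   E_k - zeta, of d_k, and of the distance from x^k to its limit. *)
Require Import Defs.
From HB Require Import structures.
From mathcomp Require Import all_boot all_order all_algebra.
From mathcomp Require Import all_classical all_reals all_analysis.
From mathcomp Require Import ring lra.
Import Order.TTheory GRing.Theory Num.Theory.
Import numFieldNormedType.Exports.
Local Open Scope classical_set_scope.
Local Open Scope ring_scope.

Set Implicit Arguments.
Unset Strict Implicit.

(** * Euclidean geometry *)

Section EuclideanSpace.
Variables (R : realType) (n : nat).
Implicit Types u v w : 'rV[R]_n.

Lemma dotvC u v : dotv u v = dotv v u.
Proof. by apply: eq_bigr => i _; rewrite mulrC. Qed.

Lemma dotvDl u v w : dotv (u + v) w = dotv u w + dotv v w.
Proof. by rewrite /dotv -big_split; apply: eq_bigr => i _; rewrite mxE mulrDl. Qed.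

Lemma dotvZl (c : R) u v : dotv (c *: u) v = c * dotv u v.
Proof. by rewrite /dotv mulr_sumr; apply: eq_bigr => i _; rewrite mxE mulrA. Qed.

Lemma dotvNl u v : dotv (- u) v = - dotv u v.
Proof. by rewrite -scaleN1r dotvZl mulN1r. Qed.

Lemma dotvDr u v w : dotv u (v + w) = dotv u v + dotv u w.
Proof. by rewrite dotvC dotvDl !(dotvC _ u). Qed.

Lemma dotvZr (c : R) u v : dotv u (c *: v) = c * dotv u v.
Proof. by rewrite dotvC dotvZl dotvC. Qed.

Lemma dotvNr u v : dotv u (- v) = - dotv u v.
Proof. by rewrite dotvC dotvNl dotvC. Qed.

Definition dotvE := (dotvDl, dotvDr, dotvNl, dotvNr, dotvZl, dotvZr).

Lemma dotv_ge0 u : 0 <= dotv u u.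
Proof. by apply: sumr_ge0 => i _; rewrite -expr2 sqr_ge0. Qed.

Lemma eucl_norm_ge0 u : 0 <= eucl_norm u.
Proof. exact: sqrtr_ge0. Qed.

Lemma sqr_eucl_norm u : eucl_norm u ^+ 2 = dotv u u.
Proof. by rewrite sqr_sqrtr // dotv_ge0. Qed.

Lemma eucl_norm0_eq0 u : eucl_norm u = 0 -> u = 0.
Proof.
move=> u0; have : dotv u u = 0 by rewrite -sqr_eucl_norm u0 expr0n.
move=> /psumr_eq0P h; apply/matrixP => i j; rewrite ord1 mxE.
have /eqP := h (fun k _ => ltac:(by rewrite -expr2 sqr_ge0)) j isT.
by rewrite -expr2 sqrf_eq0 => /eqP.
Qed.

Lemma eucl_norm0 : eucl_norm (0 : 'rV[R]_n) = 0.
Proof. by rewrite /eucl_norm -(scale0r 0) dotvZl mul0r sqrtr0. Qed.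

Lemma eucl_normZ (c : R) u : eucl_norm (c *: u) = `|c| * eucl_norm u.
Proof.
rewrite /eucl_norm dotvZl dotvZr mulrA -expr2 sqrtrM ?sqr_ge0 //.
by rewrite sqrtr_sqr.
Qed.

Lemma eucl_normN u : eucl_norm (- u) = eucl_norm u.
Proof. by rewrite -scaleN1r eucl_normZ normrN1 mul1r. Qed.

Lemma eucl_distC u v : eucl_norm (u - v) = eucl_norm (v - u).
Proof. by rewrite -eucl_normN opprB. Qed.

Lemma cauchy_schwarz u v : dotv u v <= eucl_norm u * eucl_norm v.
Proof.
have [u0|u0] := eqVneq (eucl_norm u) 0.
  by rewrite u0 mul0r (eucl_norm0_eq0 u0) -(scale0r 0) dotvZl mul0r.
have [v0|v0] := eqVneq (eucl_norm v) 0.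
  by rewrite v0 mulr0 (eucl_norm0_eq0 v0) -(scale0r 0) dotvZr mul0r.
have up : 0 < eucl_norm u by rewrite lt_def u0 eucl_norm_ge0.
have vp : 0 < eucl_norm v by rewrite lt_def v0 eucl_norm_ge0.
(* With a = |u|, b = |v|, d = <u,v>, the square of b u - a v expands to exactly 2ab(ab - d). *)
have := dotv_ge0 (eucl_norm v *: u - eucl_norm u *: v).
rewrite !dotvE -!sqr_eucl_norm (dotvC v u).
set a := eucl_norm u; set b := eucl_norm v; set d := dotv u v => h.
have : 0 <= (2 * a * b) * (a * b - d) by lra.
by rewrite pmulr_rge0 ?subr_ge0 // !mulr_gt0.
Qed.

Lemma cauchy_schwarzN u v : - dotv u v <= eucl_norm u * eucl_norm v.
Proof. by rewrite -dotvNl -(eucl_normN u) cauchy_schwarz. Qed.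

Lemma eucl_normD u v : eucl_norm (u + v) <= eucl_norm u + eucl_norm v.
Proof.
rewrite -(ler_pXn2r (n := 2)) ?nnegrE ?addr_ge0 ?eucl_norm_ge0 //.
rewrite sqrrD !sqr_eucl_norm !dotvE (dotvC v u).
have := cauchy_schwarz u v; lra.
Qed.

Lemma eucl_dist_triangle u v w :
  eucl_norm (u - w) <= eucl_norm (u - v) + eucl_norm (v - w).
Proof. by apply: le_trans (eucl_normD _ _); rewrite addrA subrK. Qed.

Lemma coord_le_eucl_norm u i : `|u 0 i| <= eucl_norm u.
Proof.
rewrite -sqrtr_sqr ler_wsqrtr // /dotv (bigD1 i) //= -expr2 lerDl.
by apply: sumr_ge0 => j _; rewrite -expr2 sqr_ge0.
Qed.

Lemma eucl_norm_le_coord u (e : R) :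
  (forall i, `|u 0 i| <= e) -> 0 <= e -> eucl_norm u <= n%:R * e.
Proof.
move=> h e0; rewrite -(ler_pXn2r (n := 2)) ?nnegrE ?mulr_ge0 ?eucl_norm_ge0 //.
rewrite sqr_eucl_norm (@le_trans _ _ (\sum_(i < n) e ^+ 2)) //.
  apply: ler_sum => i _; rewrite -expr2 -(real_normK (num_real (u 0 i))).
  by rewrite ler_pXn2r ?nnegrE.
rewrite sumr_const card_ord exprMn -[leLHS]mulr_natl ler_wpM2r ?sqr_ge0 //.
by rewrite -natrX ler_nat; case: (n) => // m; rewrite expnS leq_pmulr ?expn_gt0.
Qed.

End EuclideanSpace.

(** * Rates of convergence *)

Section Sequences.
Variable R : realType.

(** One-sided convergence to 0; the sequences it is applied to are nonnegative. *)
Definition vanishing (r : nat -> R) :=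
  forall e : R, 0 < e -> exists N, forall k, (N <= k)%N -> r k <= e.

(** The intervals of radius r_i about a_i meet pairwise, so the supremum of their left ends lies in
    all of them. *)
Lemma rated_cauchy_real (a r : nat -> R) :
  (forall i j, (i <= j)%N -> `|a i - a j| <= r i) ->
  exists s, forall i, `|a i - s| <= r i.
Proof.
move=> h.
have lu i j : a i - r i <= a j + r j.
  have rj : 0 <= r j by have := h j j (leqnn _); rewrite subrr normr0.
  have ri : 0 <= r i by have := h i i (leqnn _); rewrite subrr normr0.
  case: (leqP i j) => [ij|/ltnW ij].
    by move: (h _ _ ij); rewrite ler_norml => /andP[_]; lra.
  by move: (h _ _ ij); rewrite ler_norml => /andP[]; lra.
pose S := range (fun i => a i - r i).
have Sub j : ubound S (a j + r j) by move=> _ [i _ <-].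
have hS : has_sup S by split; [exists (a 0%N - r 0%N), 0%N | exists (a 0%N + r 0%N)].
exists (sup S) => i; rewrite ler_distlC; apply/andP; split.
  by apply: ub_le_sup; [case: hS | exists i].
by apply: ge_sup; [case: hS | exact: Sub].
Qed.

Lemma rated_cauchy_vec (n : nat) (u : nat -> 'rV[R]_n) (r : nat -> R) :
  vanishing r ->
  (forall i j, (i <= j)%N -> eucl_norm (u i - u j) <= r i) ->
  exists s, forall i, eucl_norm (u i - s) <= r i.
Proof.
move=> r0 h.
have rge0 i : 0 <= r i := le_trans (eucl_norm_ge0 _) (h i i (leqnn _)).
have coord (c : 'I_n) : exists s, forall i, `|u i 0 c - s| <= r i.
  apply: rated_cauchy_real => i j ij.
  by have := le_trans (coord_le_eucl_norm _ c) (h i j ij); rewrite !mxE.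
have [s hs] := choice coord.
exists (\row_c s c) => i; apply/ler_addgt0Pr => e e0.
have e1 : 0 < e / (n%:R + 1) by rewrite divr_gt0 // ltr_wpDl.
have [N hN] := r0 _ e1.
(* Coordinatewise bounds lose a factor n. They are used only at a late index j, where n r_j is at
   most e, so the sharp rate r_i survives. *)
pose j := maxn i N.
apply: le_trans (eucl_dist_triangle _ (u j) _) _; apply: lerD.
  by apply: h; rewrite leq_maxl.
apply: (@le_trans _ _ (n%:R * r j)).
  by apply: eucl_norm_le_coord => // c; rewrite !mxE.
apply: (@le_trans _ _ (n%:R * (e / (n%:R + 1)))).
  by rewrite ler_wpM2l // hN // leq_maxr.
by rewrite mulrCA -[leRHS]mulr1 ler_pM2l // ler_pdivrMr ?ltr_wpDl // mul1r lerDl.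
Qed.

Lemma vanishing_geometric (M q : R) : 0 <= q < 1 -> 0 <= M ->
  vanishing (fun k => M * q ^+ k).
Proof.
move=> /andP[q0 q1] M0 e e0.
have : (fun k => q ^+ k) @ \oo --> (0 : R) by apply: cvg_expr; rewrite ger0_norm.
move=> /cvgrPdist_le /(_ (e / (M + 1))) []; first by rewrite divr_gt0 // ltr_wpDl.
move=> N _ hN; exists N => k Nk; have := hN k Nk.
rewrite /= sub0r normrN ger0_norm ?exprn_ge0 // ler_pdivlMr ?ltr_wpDl //.
have := exprn_ge0 k q0; lra.
Qed.

(** Passage to the limit for estimates valid only at late indices with small r_k, for instance those
    that use r_k^2 <= r_k. *)
Lemma vanishing_le (r : nat -> R) (A B C d : R) (N : nat) :
  vanishing r -> 0 <= C -> 0 < d ->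
  (forall k, (N <= k)%N -> r k < d -> A <= B + C * r k) -> A <= B.
Proof.
move=> r0 C0 d0 h; apply/ler_addgt0Pr => e e0.
have C1 : 0 < C + 1 by rewrite ltr_wpDl.
have e1 : 0 < Num.min (d / 2) (e / (C + 1)) by rewrite lt_min !divr_gt0.
have [N' /(_ (maxn N N') (leq_maxr _ _))] := r0 _ e1.
rewrite le_min => /andP[rd re].
have := h _ (leq_maxl N N') (le_lt_trans rd _); rewrite gtr_pMr // invf_lt1 // ltr1n.
move=> /(_ isT)/le_trans; apply; rewrite lerD2l.
apply: le_trans (ler_wpM2l C0 re) _.
by rewrite mulrCA ler_piMr ?(ltW e0) // ler_pdivrMr // mul1r lerDl.
Qed.

Lemma vanishing_shift (r : nat -> R) (N : nat) : vanishing r ->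
  vanishing (fun k => r (N + k)%N).
Proof.
move=> r0 e e0; have [K hK] := r0 e e0; exists K => k Kk.
by apply: hK; apply: leq_trans Kk (leq_addl _ _).
Qed.

Lemma two_step_decay (e : nat -> R) (q : R) (K : nat) : 0 < q < 1 ->
  (forall k, 0 <= e k) -> (forall k, e k.+1 <= e k) ->
  (forall k, (K <= k)%N -> e k.+2 <= q ^+ 2 * e k) ->
  exists2 M, 0 <= M & forall k, e k <= M * q ^+ k.
Proof.
move=> /andP[q0 q1] e0 dec two.
(* This constant covers all k <= K+1 by monotonicity; from K+2 on, induction in steps of two
   applies. *)
have M0 : 0 <= e 0%N / q ^+ K.+1 by rewrite divr_ge0 ?exprn_ge0 ?(ltW q0).
exists (e 0%N / q ^+ K.+1) => // k; elim/ltn_ind: k => k IH.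
case: (leqP k K.+1) => kK.
  have ek : e k <= e 0%N by elim: (k) => // m; exact: le_trans (dec m).
  apply: (le_trans ek); rewrite mulrAC ler_pdivlMr ?exprn_gt0 //.
  by rewrite ler_wpM2l // ler_wiXn2l ?(ltW q0) ?(ltW q1).
case: k kK IH => [|[|k]] // kK IH.
apply: le_trans (two k _) _; first by move: kK; rewrite !ltnS.
have := ler_wpM2l (sqr_ge0 q) (IH k (leqW (ltnSn k))).
by rewrite mulrCA -exprD.
Qed.

(** Enlarging q to the midpoint s of q and 1 absorbs M: eventually M (q/s)^k <= 1, hence a_k <= s^k
    and the k-th root is at most s. *)
Lemma limn_esup_root_lt1 (a : nat -> R) (M q : R) :
  (forall k, 0 <= a k) -> 0 <= q < 1 -> 0 <= M ->
  (forall k, a k <= M * q ^+ k) ->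
  (limn_esup (fun k => (powR (a k) (k%:R^-1))%:E) < 1%:E)%E.
Proof.
move=> a0 /andP[q0 q1] M0 h.
pose s : R := (q + 1) / 2.
have s0 : 0 < s by rewrite /s; lra.
have s1 : s < 1 by rewrite /s; lra.
have qs : 0 <= q / s < 1.
  by rewrite divr_ge0 ?(ltW s0) //= ltr_pdivrMr // mul1r /s; lra.
have [N hN] := vanishing_geometric qs M0 (ltr01).
apply: (@le_lt_trans _ _ s%:E); last by rewrite lte_fin.
rewrite limn_esup_lim; apply: lime_le; first exact: is_cvg_esups.
(* Starting at [N.+1] excludes m = 0, where m / m = 1 fails. *)
exists N.+1 => // k /= Nk; rewrite /esups /=.
apply: ub_ereal_sup => _ [m /= km <-]; rewrite lee_fin.
have mN : (N < m)%N by exact: leq_trans Nk km.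
have am : a m <= s ^+ m.
  apply: le_trans (h m) _; have := hN m (ltnW mN).
  by rewrite expr_div_n mulrA ler_pdivrMr ?exprn_gt0 // mul1r.
apply: (@le_trans _ _ (powR (s ^+ m) m%:R^-1)).
  by apply: ge0_ler_powR; rewrite ?nnegrE ?invr_ge0 ?exprn_ge0 // ltW.
rewrite -powR_mulrn ?(ltW s0) // -powRrM divff ?powRr1 ?(ltW s0) //.
by rewrite pnatr_eq0; case: m mN {km am}.
Qed.

End Sequences.

(** * Convex functions and the proximal operator *)

Section ConvexSmooth.
Variables (R : realType) (n : nat).
Implicit Types (x y z u v w p h : 'rV[R]_n).

Lemma ler_linear_perturb (A B C : R) :
  (forall t, 0 < t <= 1 -> A <= B + t * C) -> A <= B.
Proof.
move=> hA; apply/ler_addgt0Pr => e e0.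
have C1 : 0 < `|C| + 1 by rewrite ltr_wpDl.
have t0 : 0 < Num.min 1 (e / (`|C| + 1)) by rewrite lt_min ltr01 divr_gt0.
have := hA (Num.min 1 (e / (`|C| + 1))); rewrite t0 ge_min lexx => /(_ isT).
move=> /le_trans; apply; rewrite lerD2l.
apply: (@le_trans _ _ (e / (`|C| + 1) * (`|C| + 1))); last by rewrite divfK ?gt_eqF.
apply: (@le_trans _ _ (Num.min 1 (e / (`|C| + 1)) * (`|C| + 1))).
  by rewrite ler_wpM2l ?(ltW t0) //; have := ler_norm C; lra.
by rewrite ler_wpM2r ?(ltW C1) // ge_min lexx orbT.
Qed.

Lemma convex_gradient_le (f : 'rV[R]_n -> R) gf : convex_fun f -> is_gradient f gf ->
  forall x z, f x + dotv (gf x) (z - x) <= f z.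
Proof.
move=> cf df x z; set h := z - x; set N := eucl_norm h.
have N0 : 0 <= N := eucl_norm_ge0 h.
apply: (@ler_linear_perturb _ _ N) => e /andP[e0 _].
have [del d0 hd] := df x e e0.
(* A convex weight small enough for t h to lie in the ball where the first-order expansion holds;
   [N + 1] also handles h = 0. *)
pose t := Num.min 1 (del / (N + 1)).
have N1 : 0 < N + 1 by rewrite ltr_wpDl.
have t0 : 0 < t by rewrite lt_min ltr01 divr_gt0.
have t1 : t <= 1 by rewrite ge_min lexx.
have tN : eucl_norm (t *: h) < del.
  rewrite eucl_normZ gtr0_norm // -/N.
  apply: (@lt_le_trans _ _ (t * (N + 1))); first by rewrite ltr_pM2l // ltrDl.
  by rewrite -ler_pdivlMr // ge_min lexx orbT.
have := hd _ tN; rewrite ler_norml => /andP[+ _].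
rewrite dotvZr eucl_normZ (gtr0_norm t0) -/N => h1.
have := cf z x t; rewrite (ltW t0) t1 => /(_ isT).
have -> : t *: z + (1 - t) *: x = x + t *: h.
  by apply/matrixP => i j; rewrite /h !mxE; ring.
move=> h2.
have : t * (f x + dotv (gf x) h) <= t * (f z + e * N) by lra.
by rewrite ler_pM2l.
Qed.

(* Applying the bound with constant C on both halves of a segment
   improves C to C / 2 + L / 4, whose fixed point is L / 2. *)
Lemma convex_descent (f : 'rV[R]_n -> R) gf (L : R) :
  convex_fun f -> is_gradient f gf -> 0 <= L -> lipschitz_mod gf L ->
  forall x z, f z <= f x + dotv (gf x) (z - x) + L / 2 * eucl_norm (z - x) ^+ 2.
Proof.
move=> cf df L0 lip.
have lipd x h (t : R) : 0 <= t ->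
    dotv (gf (x + t *: h)) h <= dotv (gf x) h + t * L * eucl_norm h ^+ 2.
  move=> t0; have := cauchy_schwarz (gf (x + t *: h) - gf x) h.
  rewrite dotvDl dotvNl => cs.
  have := lip (x + t *: h) x; rewrite addrAC subrr add0r eucl_normZ (ger0_norm t0) => li.
  have := ler_wpM2r (eucl_norm_ge0 h) li; lra.
have H (m : nat) x h : f (x + h) <= f x + dotv (gf x) h +
    (L / 2 + L / 2 * 2^-1 ^+ m) * eucl_norm h ^+ 2.
  (* For m = 0 the constant is L, obtained from the gradient inequality at x + h. *)
  elim: m x h => [|m IH] x h.
    have := convex_gradient_le cf df (x + h) x.
    rewrite opprD addNKr dotvNr.
    have := lipd x h 1 ler01; rewrite scale1r expr0; lra.
  have h1 := IH x (2^-1 *: h).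
  have h2 := IH (x + 2^-1 *: h) (2^-1 *: h).
  have h3 := lipd x h 2^-1 ltac:(lra).
  have hh : x + 2^-1 *: h + 2^-1 *: h = x + h.
    by apply/matrixP => i j; rewrite !mxE; field.
  move: h1 h2; rewrite hh !dotvZr !eucl_normZ.
  rewrite (exprS _ m) !exprMn ger0_norm ?invr_ge0 //.
  set q := _ ^+ m; set N2 := _ ^+ 2 in h3 *.
  lra.
move=> x z; apply/ler_addgt0Pr => e e0.
have M0 : 0 <= L / 2 * eucl_norm (z - x) ^+ 2.
  by rewrite mulr_ge0 ?sqr_ge0 // divr_ge0.
have q01 : 0 <= (2^-1 : R) < 1 by apply/andP; split; lra.
have [N /(_ N (leqnn N)) hN] := vanishing_geometric q01 M0 e0.
have := H N x (z - x); rewrite addrC subrK; lra.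
Qed.

(** * Extended-valued convex functions and their proximal points *)

Lemma ereal_le_real (y : \bar R) (a : R) : y != -oo%E -> (y <= a%:E)%E ->
  y = (fine y)%:E /\ fine y <= a.
Proof. by case: y => [r||] //= _; rewrite lee_fin. Qed.

Lemma proper_fin_num (g : 'rV[R]_n -> \bar R) z : proper_fun g ->
  (g z < +oo)%E -> g z \is a fin_num.
Proof. by move=> [gN _]; rewrite fin_numE gN ltey. Qed.

(** Lower semicontinuity in sequential form. The bound on g(w_k) is asked only where r_k < 1, so
    that quadratic errors can be absorbed into C r_k. *)
Lemma closed_fun_le (g : 'rV[R]_n -> \bar R) p (w : nat -> 'rV[R]_n)
    (r : nat -> R) (a C : R) : closed_fun g -> 0 <= C ->
  vanishing r -> (forall k, eucl_norm (w k - p) <= r k) ->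
  (forall k, r k < 1 -> (g (w k) <= (a + C * r k)%:E)%E) -> (g p <= a%:E)%E.
Proof.
move=> cg C0 r0 wp gw; rewrite leNgt; apply/negP => ap.
have [b ab bp] : exists2 b, a < b & (b%:E < g p)%E.
  case: (g p) ap => [c||] //; rewrite ?lte_fin => ap.
    by exists ((a + c) / 2); rewrite ?lte_fin; lra.
  by exists (a + 1); rewrite ?ltry ?ltrDl.
have [del d0 hd] := cg p b bp.
suff : b <= a by rewrite leNgt ab.
have d1 : 0 < Num.min del 1 by rewrite lt_min d0 ltr01.
apply: (@vanishing_le _ r b a C _ 0%N r0 C0 d1) => k _; rewrite lt_min => /andP[rd r1].
rewrite -lee_fin; apply: le_trans (gw k r1); apply/ltW/hd.
exact: le_lt_trans (wp k) rd.
Qed.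

Lemma prox_fin_num (g : 'rV[R]_n -> \bar R) (L : R) v p : proper_fun g -> 0 < L ->
  is_prox (scale_efun L^-1 g) v p -> g p \is a fin_num.
Proof.
move=> pg L0 hp; apply: (proper_fin_num pg); case: pg => gN [z0 z0f].
have := hp z0; rewrite /scale_efun -(fineK z0f).
have := gN p; case: (g p) => [r||] //= _; first by rewrite ltry.
by rewrite gt0_muley ?lte_fin ?invr_gt0.
Qed.

(** Fermat's rule: compare p with the points p + t(y - p), divide by t and let t tend to 0. *)
Lemma prox_subgrad (g : 'rV[R]_n -> \bar R) (L : R) v p :
  proper_fun g -> convex_efun g -> 0 < L ->
  is_prox (scale_efun L^-1 g) v p -> subgrad g p (L *: (v - p)).
Proof.
move=> pg cg L0 hp; have pf := prox_fin_num pg L0 hp; split=> // y.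
case: (ltP (g y) +oo%E) => [yf|]; last by rewrite leye_eq => /eqP ->; exact: leey.
have {}yf := proper_fin_num pg yf.
set a := fine (g p); rewrite -(fineK yf) lee_fin; set b := fine (g y).
apply: (@ler_linear_perturb _ _ (L / 2 * dotv (y - p) (y - p))) => t /andP[t0 t1].
have := cg y p t; rewrite (ltW t0) t1 => /(_ isT).
rewrite -(fineK yf) -(fineK pf) !ltry => /(_ isT isT).
rewrite -/a -/b -!EFinM -EFinD => /(ereal_le_real (pg.1 _)) [qE qle].
have := hp (t *: y + (1 - t) *: p).
rewrite /scale_efun qE -(fineK pf) -/a -!EFinM -!EFinD lee_fin !sqr_eucl_norm.
have -> : t *: y + (1 - t) *: p - v = (p - v) + t *: (y - p).
  by apply/matrixP => i j; rewrite !mxE; ring.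
rewrite -(opprB p v) !(dotvDl (p - v)) !(dotvDr _ (p - v)) !dotvZl !dotvZr dotvNl.
rewrite (dotvC (y - p) (p - v)).
set q := fine _ in qle *; set A := dotv (p - v) (p - v); set B := dotv (p - v) (y - p).
set D := dotv _ _ => h.
have {}h : L^-1 * a <= L^-1 * q + (t * B + t * t * D / 2) by lra.
have := ler_wpM2l (ltW L0) h.
rewrite mulrDr !mulVKf ?gt_eqF // => {}h.
have : t * (a + L * - B) <= t * (b + t * (L / 2 * D)) by lra.
by rewrite ler_pM2l.
Qed.

Lemma subgrad_le (g : 'rV[R]_n -> \bar R) x v z : subgrad g x v -> g z \is a fin_num ->
  fine (g x) + dotv v (z - x) <= fine (g z).
Proof. by move=> [_ /(_ z)] + zf; rewrite -{1}(fineK zf) lee_fin. Qed.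

(** Adding the subgradient inequalities at p and q gives |p - q|^2 <= <u - v, p - q>. *)
Lemma prox_nonexpansive (g : 'rV[R]_n -> \bar R) (L : R) u v p q :
  proper_fun g -> convex_efun g -> 0 < L ->
  is_prox (scale_efun L^-1 g) u p -> is_prox (scale_efun L^-1 g) v q ->
  eucl_norm (p - q) <= eucl_norm (u - v).
Proof.
move=> pg cg L0 /(prox_subgrad pg cg L0) hp /(prox_subgrad pg cg L0) hq.
have h1 := subgrad_le hp hq.1; have h2 := subgrad_le hq hp.1.
have h : L * dotv (p - q) (p - q) <= L * dotv (u - v) (p - q).
  move: h1 h2; rewrite !dotvE !(dotvC q p); lra.
rewrite ler_pM2l // -sqr_eucl_norm in h.
have := le_trans h (cauchy_schwarz _ _).
have [->|pq] := eqVneq (eucl_norm (p - q)) 0; first by rewrite eucl_norm_ge0.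
by rewrite expr2 ler_pM2r // lt_def pq eucl_norm_ge0.
Qed.

(* A minimizing sequence is Cauchy by strong convexity; the subgradient only
   serves to bound the objective from below. *)
Lemma prox_exists (g : 'rV[R]_n -> \bar R) (L : R) x0 v0 v :
  proper_fun g -> convex_efun g -> closed_fun g -> 0 < L -> subgrad g x0 v0 ->
  exists p, is_prox (scale_efun L^-1 g) v p.
Proof.
move=> pg cg lg L0 sg.
have Li : 0 < L^-1 by rewrite invr_gt0.
pose h z := L^-1 * fine (g z) + dotv (z - v) (z - v) / 2.
pose S := h @` [set z | g z \is a fin_num].
have Slb : has_inf S.
  split; first by case: pg => _ [z0 z0f]; exists (h z0), z0.
  (* The subgradient inequality bounds h below by a quadratic in z - v; completing the square gives
     this constant. *)
  exists (L^-1 * fine (g x0) + dotv (L^-1 *: v0) (v - x0) -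
     dotv (L^-1 *: v0) (L^-1 *: v0) / 2) => _ [z zf <-].
  have h1 := ler_wpM2l (ltW Li) (subgrad_le sg zf).
  have := dotv_ge0 (L^-1 *: v0 + (z - v)).
  rewrite (dotvDl (_ *: _)) !(dotvDr _ (L^-1 *: _)) (dotvC (z - v)) /h.
  have : dotv (L^-1 *: v0) (z - v) + dotv (L^-1 *: v0) (v - x0)
       = L^-1 * dotv v0 (z - x0) by rewrite -dotvDr addrA subrK dotvZl.
  move: h1; rewrite mulrDr; lra.
set m := inf S.
have mle z : g z \is a fin_num -> m <= h z by move=> zf; apply: ge_inf; [case: Slb|exists z].
pose r (k : nat) : R := 1 * 2^-1 ^+ k.
have r0 k : 0 < r k by rewrite mulr_gt0 ?exprn_gt0 ?invr_gt0.
have r1 i j : (i <= j)%N -> r j <= r i.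
  by move=> ij; rewrite /r !mul1r ler_wiXn2l ?invr_ge0 // invf_le1 ?ler1n.
(* At the midpoint, h is at most the mean of its two values minus |z_i - z_j|^2 / 8. Since h >= m
   there, the tolerance r_k^2 / 8 yields |z_i - z_j| <= r_i for i <= j. *)
have adh k : exists z, g z \is a fin_num /\ h z < m + r k ^+ 2 / 8.
  have [_ [z zf <-] hz] := inf_adherent (divr_gt0 (exprn_gt0 2 (r0 k)) (ltr0Sn _ 7)) Slb.
  by exists z.
have [z hz] := choice adh.
have rv : vanishing r by apply: vanishing_geometric => //; apply/andP; split; lra.
have [] := @rated_cauchy_vec _ _ z r rv.
  move=> i j ij; rewrite -(ler_pXn2r (n := 2)) ?nnegrE ?eucl_norm_ge0 ?ltW //.
  have [zif hi] := hz i; have [zjf hj] := hz j.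
  have rij : r j ^+ 2 <= r i ^+ 2 by rewrite ler_pXn2r ?nnegrE ?(ltW (r0 _)) ?r1.
  have := cg (z i) (z j) 2^-1; rewrite -{1}(fineK zif) -{1}(fineK zjf) !ltry.
  have -> : 0 <= (2^-1 : R) <= 1 by apply/andP; split; lra.
  move=> /(_ isT isT isT); rewrite -(fineK zif) -(fineK zjf) -!EFinM -EFinD.
  move=> /(ereal_le_real (pg.1 _)) [qE qle].
  have := mle (2^-1 *: z i + (1 - 2^-1) *: z j); rewrite qE => /(_ isT).
  rewrite /h; have := ler_wpM2l (ltW Li) qle; move: hi hj; rewrite /h.
  have -> : 2^-1 *: z i + (1 - 2^-1) *: z j - v = 2^-1 *: ((z i - v) + (z j - v)).
    by apply/matrixP => a b; rewrite !mxE; field.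
  rewrite sqr_eucl_norm; have -> : z i - z j = (z i - v) - (z j - v).
    by rewrite opprB addrA subrK.
  move: (z i - v) (z j - v) => a b; rewrite !dotvE (dotvC b a).
  set q := fine (g (_ + _)); lra.
move=> p hp; exists p.
(* This bound says that h(p) <= m, so the infimum is attained at p. *)
have gp : (g p <= (L * (m - dotv (p - v) (p - v) / 2))%:E)%E.
  apply: (@closed_fun_le _ _ z r _ (L * (1 + eucl_norm (p - v)))) => //.
    by rewrite mulr_ge0 ?addr_ge0 ?eucl_norm_ge0 ?(ltW L0).
  move=> k _; have [zkf hk] := hz k; rewrite -(fineK zkf) lee_fin.
  have := ltW hk; rewrite /h; have -> : z k - v = (p - v) + (z k - p).
    by rewrite [RHS]addrC addrA subrK.
  rewrite (dotvDl (p - v)) !(dotvDr _ (p - v)) (dotvC (z k - p)).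
  have := cauchy_schwarzN (p - v) (z k - p).
  have := ler_wpM2l (eucl_norm_ge0 (p - v)) (hp k).
  have := dotv_ge0 (z k - p).
  have : r k ^+ 2 <= r k.
    by rewrite expr2 ler_piMl ?(ltW (r0 k)) // (le_trans (r1 0%N k _)) // /r mul1r expr0.
  have := r0 k.
  move: (dotv (p - v) (p - v)) (dotv (p - v) (z k - p)) (dotv (z k - p) _)
    (eucl_norm (p - v)) (eucl_norm (z k - p)) (r k) => A B D N M s s0 s2 D0 h1 h2 h3.
  have : L^-1 * fine (g (z k)) <= m - A / 2 + (1 + N) * s by lra.
  move=> /(ler_wpM2l (ltW L0)); rewrite mulVKf ?gt_eqF //; lra.
have [pE pl] := ereal_le_real (pg.1 _) gp.
move=> y; rewrite /scale_efun.
case: (ltP (g y) +oo%E) => [yf|]; last first.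
  by rewrite leye_eq => /eqP ->; rewrite gt0_muley ?lte_fin // addye // leey.
have {}yf := proper_fin_num pg yf; have := mle y yf.
rewrite pE -(fineK yf) -!EFinM -!EFinD lee_fin !sqr_eucl_norm /h.
by have := ler_wpM2l (ltW Li) pl; rewrite mulKf ?gt_eqF //; lra.
Qed.

End ConvexSmooth.

(** * Proximal gradient with extrapolation *)

Section ProximalGradient.
Variables (R : realType) (n : nat) (g : 'rV[R]_n -> \bar R).
Variables (f : 'rV[R]_n -> R) (gf : 'rV[R]_n -> 'rV[R]_n) (L l : R).
Hypotheses (pg : proper_fun g) (cg : convex_efun g) (lg : closed_fun g).
Hypotheses (L0 : 0 < L) (l0 : 0 <= l) (lL : l <= L).
(** The splitting f = f1 - f2 enters this section only through these bounds: f1 limits the upper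
    curvature by L, f2 the lower one by -l. *)
Hypothesis f_upper : forall x z,
  f z <= f x + dotv (gf x) (z - x) + L / 2 * eucl_norm (z - x) ^+ 2.
Hypothesis f_lower : forall x z,
  f x + dotv (gf x) (z - x) - l / 2 * eucl_norm (z - x) ^+ 2 <= f z.
Hypothesis gf_lip : lipschitz_mod gf (L + l).

Definition stationary (z : 'rV[R]_n) := exists v, subgrad g z v /\ gf z + v = 0.
Definition proxgrad (z p : 'rV[R]_n) :=
  is_prox (scale_efun L^-1 g) (z - L^-1 *: gf z) p.
(** Since [fine] sends [+oo] to 0, this equals F only on dom g, whence the [fin_num] side
    conditions. *)
Definition objective (z : 'rV[R]_n) := f z + fine (g z).

Lemma stationary_fin_num z : stationary z -> g z \is a fin_num.
Proof. by case=> v [[]]. Qed.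

(** The subgradient of g cancels the gradient of f, so only the lower curvature term of f is
    lost. *)
Lemma stationary_le w z : stationary w -> g z \is a fin_num ->
  objective w - l / 2 * eucl_norm (z - w) ^+ 2 <= objective z.
Proof.
move=> [v [sv /eqP]]; rewrite addr_eq0 => /eqP vE zf.
have := subgrad_le sv zf; have := f_lower w z; rewrite vE dotvNl /objective; lra.
Qed.

Lemma proxgrad_fin_num z p : proxgrad z p -> g p \is a fin_num.
Proof. exact: prox_fin_num. Qed.

Lemma proxgrad_subgrad z p : proxgrad z p -> subgrad g p (L *: (z - p) - gf z).
Proof.
move=> /(prox_subgrad pg cg L0); have -> // : L *: (z - L^-1 *: gf z - p) = L *: (z - p) - gf z.
by rewrite addrAC scalerBr scalerA divff ?gt_eqF // scale1r.
Qed.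

Lemma proxgrad_fix_stationary z : proxgrad z z -> stationary z.
Proof.
move=> /proxgrad_subgrad; rewrite subrr scaler0 sub0r => sz.
by exists (- gf z); rewrite subrr.
Qed.

(** Sum of the upper bound on f from y to p, the lower bound from y to z, and the subgradient
    inequality at p; the rest is |p-y|^2 - 2<y-p,z-p> = |z-y|^2 - |z-p|^2. *)
Lemma proxgrad_descent y p z : proxgrad y p -> g z \is a fin_num ->
  objective p <= objective z + (L + l) / 2 * eucl_norm (z - y) ^+ 2
                 - L / 2 * eucl_norm (z - p) ^+ 2.
Proof.
move=> /proxgrad_subgrad sp zf; have := subgrad_le sp zf.
have := f_upper y p; have := f_lower y z; rewrite /objective !sqr_eucl_norm.
rewrite !dotvE !(dotvC y z) !(dotvC p z) !(dotvC p y); lra.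
Qed.

(** The factor is 1 + (L+l)/L, at most 3 because l <= L. *)
Lemma proxgrad_dist y z p q : proxgrad y p -> proxgrad z q ->
  eucl_norm (p - q) <= 3 * eucl_norm (y - z).
Proof.
move=> hp hq; apply: le_trans (prox_nonexpansive pg cg L0 hp hq) _.
have -> : y - L^-1 *: gf y - (z - L^-1 *: gf z) = (y - z) - L^-1 *: (gf y - gf z).
  by rewrite scalerBr !opprB addrACA [RHS]addrACA; congr (_ + _); rewrite addrC.
apply: le_trans (eucl_normD _ _) _; rewrite eucl_normN eucl_normZ.
rewrite ger0_norm ?invr_ge0 ?(ltW L0) //.
have : L^-1 * eucl_norm (gf y - gf z) <= 2 * eucl_norm (y - z); last by lra.
rewrite mulrC ler_pdivrMr //; apply: le_trans (gf_lip _ _) _.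
have := ler_wpM2r (eucl_norm_ge0 (y - z)) lL; lra.
Qed.

(** The common value gives g(w_k) = zeta - f(w_k), so lower semicontinuity yields g(s) <= zeta -
    f(s); then the subgradient inequalities at w_k pass to the limit. *)
Lemma stationary_limit (w : nat -> 'rV[R]_n) (r : nat -> R) (zeta : R) s :
  vanishing r -> (forall k, eucl_norm (w k - s) <= r k) ->
  (forall k, stationary (w k)) -> (forall k, objective (w k) = zeta) ->
  stationary s.
Proof.
move=> r0 ws wst wz.
have rge0 k : 0 <= r k := le_trans (eucl_norm_ge0 _) (ws k).
have sq k : r k < 1 -> eucl_norm (w k - s) ^+ 2 <= r k.
  move=> r1; apply: (@le_trans _ _ (r k ^+ 2)).
    by rewrite ler_pXn2r ?nnegrE ?eucl_norm_ge0.
  by rewrite expr2 ler_piMl // ltW.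
have gs : (g s <= (zeta - f s)%:E)%E.
  apply: (@closed_fun_le _ _ g s w r _ (eucl_norm (gf s) + l / 2)) => //.
    by rewrite addr_ge0 ?eucl_norm_ge0 // divr_ge0.
  move=> k r1; rewrite -(fineK (stationary_fin_num (wst k))) lee_fin.
  have := wz k; have := f_lower s (w k); rewrite /objective.
  have := cauchy_schwarzN (gf s) (w k - s).
  have := ler_wpM2l (eucl_norm_ge0 (gf s)) (ws k).
  have := ler_wpM2l l0 (sq k r1); lra.
have [sE sle] := ereal_le_real (pg.1 _) gs.
have sf : g s \is a fin_num by rewrite sE.
exists (- gf s); split; last by rewrite subrr.
split=> // y; case: (ltP (g y) +oo%E) => [yf|]; last by rewrite leye_eq => /eqP ->; exact: leey.
have {}yf := proper_fin_num pg yf; rewrite -(fineK yf) lee_fin.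
(* Replacing g(s) by its upper bound leaves a quantity that is the limit of the estimates at w_k. *)
apply: le_trans (_ : zeta - f s - dotv (gf s) (y - s) <= _).
  by rewrite dotvNl lerD2r.
have Ll : 0 <= L + l by rewrite addr_ge0 // ltW.
apply: (@vanishing_le _ r _ _ (L / 2 + (L + l) * (eucl_norm (y - s) + 1)) 1 0%N) => //.
  by rewrite addr_ge0 ?mulr_ge0 ?addr_ge0 ?eucl_norm_ge0 ?divr_ge0 ?(ltW L0).
move=> k _ r1; have [v [sv /eqP]] := wst k; rewrite addr_eq0 => /eqP vE.
have := subgrad_le sv yf; have := wz k; have := f_upper s (w k).
have := cauchy_schwarz (gf (w k) - gf s) (y - w k).
have h1 : eucl_norm (y - w k) <= eucl_norm (y - s) + 1.
  apply: le_trans (eucl_dist_triangle _ s _) _; rewrite lerD2l eucl_distC.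
  exact: le_trans (ws k) (ltW r1).
have h2 : eucl_norm (gf (w k) - gf s) <= (L + l) * r k.
  by apply: le_trans (gf_lip _ _) _; rewrite ler_wpM2l.
have := ler_pM (eucl_norm_ge0 _) (eucl_norm_ge0 _) h2 h1.
have := ler_wpM2l (ltW L0) (sq k r1).
rewrite /objective vE !dotvE; lra.
Qed.

(** * The iterates and their energy *)

Variables (x : nat -> 'rV[R]_n) (beta : nat -> R) (b m : R).
Hypothesis x0_fin : g (x 0%N) \is a fin_num.
Hypothesis beta_bound : forall k, 0 <= beta k <= b.
Hypothesis b_small : (L + l) * b ^+ 2 < L.
(** As [0.-1] is 0, the convention x^(-1) = x^0 is built in. *)
Hypothesis xS : forall k, proxgrad (x k + beta k *: (x k - x k.-1)) (x k.+1).
Hypothesis objective_lb : forall k, m <= objective (x k).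

Let y k := x k + beta k *: (x k - x k.-1).
Let d k := eucl_norm (x k - x k.-1).
Let E k := objective (x k) + L / 2 * d k ^+ 2.
Let c := (L - (L + l) * b ^+ 2) / 2.

Lemma iterate_fin_num k : g (x k) \is a fin_num.
Proof. by case: k => [//|k]; exact: proxgrad_fin_num (xS k). Qed.

Let d_ge0 k : 0 <= d k. Proof. exact: eucl_norm_ge0. Qed.
Let c_gt0 : 0 < c. Proof. by rewrite divr_gt0 // subr_gt0. Qed.
Let Ll0 : 0 < L + l. Proof. by rewrite ltr_wpDr. Qed.

Let beta_le1 k : beta k <= 1.
Proof.
have /andP[b0 bb] := beta_bound k; apply: le_trans bb _.
rewrite leNgt; apply/negP => b1.
have : 1 < b ^+ 2 by rewrite exprn_egt1.
rewrite -(ltr_pM2l Ll0) => h; have := lt_trans h b_small.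
by rewrite mulr1 gtrDl ltNge l0.
Qed.

Let dist_extrap k : eucl_norm (x k - y k) <= d k.
Proof.
rewrite /y opprD addNKr eucl_normN eucl_normZ.
have /andP[b0 _] := beta_bound k.
by rewrite ger0_norm // ler_piMl // ?d_ge0 ?beta_le1.
Qed.

(** At z = x_k the extrapolation costs (L+l)/2 beta_k^2 d_k^2, which is at most (L/2 - c) d_k^2. *)
Lemma energy_decrease k : E k.+1 <= E k - c * d k ^+ 2.
Proof.
have := proxgrad_descent (xS k) (iterate_fin_num k); rewrite -/(y k) /E /c.
rewrite [eucl_norm (x k - x k.+1)]eucl_distC -/(d k.+1).
have -> : eucl_norm (x k - y k) ^+ 2 = beta k ^+ 2 * d k ^+ 2.
  by rewrite /y opprD addNKr eucl_normN eucl_normZ exprMn real_normK ?num_real.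
have /andP[b0 bb] := beta_bound k.
have : beta k ^+ 2 <= b ^+ 2 by rewrite ler_pXn2r ?nnegrE // (le_trans b0).
move=> /(ler_wpM2r (sqr_ge0 (d k)))/(ler_wpM2l (ltW Ll0)); lra.
Qed.

Let E_noninc i j : (i <= j)%N -> E j <= E i.
Proof.
move=> /subnK <-; elim: (j - i)%N => [//|k IH]; rewrite addSn.
apply: le_trans (energy_decrease _) _.
by rewrite lerBlDr (le_trans IH) // lerDl mulr_ge0 ?sqr_ge0 // ltW.
Qed.

(** Here d_0 = 0, so E_0 = F(x^0). One level, xi = F(x^0), thus serves all iterates in the error
    bound. *)
Lemma objective_le0 k : objective (x k) <= objective (x 0%N).
Proof.
have := E_noninc (leq0n k); rewrite /E {2}/d subrr eucl_norm0 expr0n mulr0 addr0.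
by apply: le_trans; rewrite lerDl mulr_ge0 ?sqr_ge0 // divr_ge0 // ltW.
Qed.

Let E_lb k : m <= E k.
Proof.
by rewrite (le_trans (objective_lb k)) // lerDl mulr_ge0 ?sqr_ge0 // divr_ge0 // ltW.
Qed.

Lemma step_vanishing : vanishing d.
Proof.
move=> e e0.
have hi : has_inf (range E).
  by split; [exists (E 0%N), 0%N | exists m => _ [k _ <-]; exact: E_lb].
have ce : 0 < c * e ^+ 2 by rewrite mulr_gt0 ?exprn_gt0.
(* Once E_N is within c e^2 of the infimum, no later drop c d_k^2 can exceed c e^2. *)
have [_ [N _ <-] hN] := inf_adherent ce hi.
exists N => k Nk; rewrite -(ler_pXn2r (n := 2)) ?nnegrE ?(ltW e0) //.
rewrite -(ler_pM2l c_gt0).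
have := energy_decrease k; have := E_noninc Nk.
have : inf (range E) <= E k.+1 by apply: ge_inf; [case: hi | exists k.+1].
lra.
Qed.

Let r k := d k + d k.+1.

Let r_vanishing : vanishing r.
Proof.
move=> e e0; have [N hN] := step_vanishing (divr_gt0 e0 (ltr0Sn _ 1)).
exists N => k Nk; have := hN k Nk; have := hN k.+1 (leqW Nk); rewrite /r; lra.
Qed.

(** Since x_(k+1) is the proximal step from y_k, |p - x_(k+1)| <= 3 |x_k - y_k| <= 3 d_k. *)
Lemma residual_le k p : proxgrad (x k) p -> eucl_norm (p - x k) <= 3 * r k.
Proof.
move=> hp; apply: le_trans (eucl_dist_triangle _ (x k.+1) _) _.
have := proxgrad_dist hp (xS k); rewrite -/(y k).
have := dist_extrap k; have := d_ge0 k.+1; rewrite /r /d /=; lra.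
Qed.

Lemma proxgrad_exists z : exists p, proxgrad z p.
Proof. exact: (prox_exists _ pg cg lg L0 (proxgrad_subgrad (xS 0%N))). Qed.

(** The error bound at the level F(x^0), with an actual stationary point in place of the distance
    infimum. *)
Hypothesis error_bound : exists eps tau : R, [/\ 0 < eps, 0 < tau &
  forall z p, proxgrad z p -> eucl_norm (p - z) < eps -> g z \is a fin_num ->
    objective z <= objective (x 0%N) ->
    exists2 w, stationary w & eucl_norm (z - w) <= tau * eucl_norm (p - z)].
Hypothesis separated : exists2 del : R, 0 < del &
  forall z w, stationary z -> stationary w -> objective z <> objective w ->
    del <= eucl_norm (z - w).

(** * Nearby stationary points and the linear rate *)

Lemma near_stationary : exists (kappa : R) (N : nat) (w : nat -> 'rV[R]_n),
  0 < kappa /\ forall k, (N <= k)%N ->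
    stationary (w k) /\ eucl_norm (x k - w k) <= kappa * r k.
Proof.
have [eps [tau [eps0 tau0 eb]]] := error_bound.
(* With r_k <= eps/4 the residual, at most 3 r_k, is strictly below eps. *)
have [N hN] := r_vanishing (divr_gt0 eps0 (ltr0Sn _ 3)).
have ex k : exists w, (N <= k)%N ->
    stationary w /\ eucl_norm (x k - w) <= tau * 3 * r k.
  case: (leqP N k) => [Nk|]; last by exists 0.
  have [p hp] := proxgrad_exists (x k).
  have res := residual_le hp.
  have pe : eucl_norm (p - x k) < eps by have := hN k Nk; lra.
  have [w sw wle] := eb _ _ hp pe (iterate_fin_num k) (objective_le0 k).
  exists w => _; split=> //; apply: (le_trans wle).
  by rewrite -mulrA ler_pM2l.
have [w hw] := choice ex.
by exists (tau * 3), N, w; split=> //; rewrite mulr_gt0.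
Qed.

Lemma near_stationary_level : exists (kappa zeta : R) (N : nat) (w : nat -> 'rV[R]_n),
  0 < kappa /\ forall k, (N <= k)%N ->
    [/\ stationary (w k), eucl_norm (x k - w k) <= kappa * r k & objective (w k) = zeta].
Proof.
have [kappa [N [w [k0 hw]]]] := near_stationary.
have [del del0 sep] := separated.
(* When r_j and r_(j+1) are at most del/(4 kappa + 2), the points w_j and w_(j+1) are at most (2
   kappa + 1) del/(4 kappa + 2) = del/2 apart, so separation forces equal values. *)
have C0 : 0 < 4 * kappa + 2 by lra.
have [N' hN'] := r_vanishing (divr_gt0 del0 C0).
exists kappa, (objective (w (maxn N N'))), (maxn N N'), w; split=> // k.
move=> Mk; have Nk : (N <= k)%N by apply: leq_trans (leq_maxl _ _) Mk.
have [sw wle] := hw k Nk; split=> //.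
move: Mk => /subnK <-; elim: (k - _)%N => [//|i IH].
rewrite -{}IH addSn; set j := (i + _)%N.
have Nj : (N <= j)%N by rewrite (leq_trans (leq_maxl N N')) // leq_addl.
have N'j : (N' <= j)%N by rewrite (leq_trans (leq_maxr N N')) // leq_addl.
have [sj jle] := hw j Nj; have [sj1 j1le] := hw j.+1 (leqW Nj).
case: (eqVneq (objective (w j.+1)) (objective (w j))) => [//|/eqP ne].
have := sep _ _ sj1 sj ne.
have t1 := eucl_dist_triangle (w j.+1) (x j.+1) (w j).
have t2 := eucl_dist_triangle (x j.+1) (x j) (w j).
rewrite (eucl_distC (w j.+1) (x j.+1)) in t1.
have h1 := hN' j N'j; have h2 := hN' j.+1 (leqW N'j).
rewrite ler_pdivlMr // in h1; rewrite ler_pdivlMr // in h2.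
have dr : eucl_norm (x j.+1 - x j) <= r j by rewrite /r lerDr.
have ? : 0 <= r j by rewrite addr_ge0.
have ? : 0 <= r j.+1 by rewrite addr_ge0.
move=> le; have ? : 0 <= kappa * r j by rewrite mulr_ge0 // ltW.
have ? : 0 <= kappa * r j.+1 by rewrite mulr_ge0 // ltW.
have : del < del by lra.
by rewrite ltxx.
Qed.

Lemma energy_two_step kappa zeta N (w : nat -> 'rV[R]_n) : 0 < kappa ->
  (forall k, (N <= k)%N -> [/\ stationary (w k),
     eucl_norm (x k - w k) <= kappa * r k & objective (w k) = zeta]) ->
  (forall k, zeta <= E k) /\
  exists2 A, 0 < A & forall k, (N <= k)%N ->
    E k.+2 - zeta <= A * (E k - E k.+2).
Proof.
move=> kappa0 hw.
have r_ge0 k : 0 <= r k by rewrite addr_ge0.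
split=> [k|].
  (* For late j, zeta <= F(x_j) + l/2 |x_j - w_j|^2 and F(x_j) <= E_j <= E_k; let j tend to
     infinity. *)
  apply: (@vanishing_le _ r _ _ (l / 2 * kappa ^+ 2) 1 (maxn N k) r_vanishing) => //.
    by rewrite mulr_ge0 ?sqr_ge0 // divr_ge0.
  move=> j; rewrite geq_max => /andP[Nj kj] r1; have [sw wle wz] := hw j Nj.
  have := stationary_le sw (iterate_fin_num j); rewrite wz.
  have : eucl_norm (x j - w j) ^+ 2 <= kappa ^+ 2 * r j.
    apply: (@le_trans _ _ ((kappa * r j) ^+ 2)).
      by rewrite ler_pXn2r ?nnegrE ?eucl_norm_ge0 // mulr_ge0 // ltW.
    by rewrite exprMn ler_wpM2l ?sqr_ge0 // expr2 ler_piMl // ltW.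
  move=> /(ler_wpM2l l0); have := E_noninc kj.
  have : objective (x j) <= E j by rewrite lerDl mulr_ge0 ?sqr_ge0 // divr_ge0 // ltW.
  lra.
(* The first term comes from |w_k - y_k|^2 <= 2 (kappa+1)^2 (d_k^2 + d_(k+1)^2), the second covers
   L/2 d_(k+1)^2 in E_(k+1). Two energy drops then bound c (d_k^2 + d_(k+1)^2). *)
pose C := (L + l) * (kappa + 1) ^+ 2 + L.
have C0 : 0 < C by rewrite ltr_wpDl // mulr_ge0 ?sqr_ge0 // ltW.
exists (C / c); first by rewrite divr_gt0.
move=> k Nk; have [sw wle wz] := hw k Nk.
have h1 : eucl_norm (w k - y k) ^+ 2 <= (kappa + 1) ^+ 2 * (2 * (d k ^+ 2 + d k.+1 ^+ 2)).
  apply: (@le_trans _ _ (((kappa + 1) * r k) ^+ 2)).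
    rewrite ler_pXn2r ?nnegrE ?eucl_norm_ge0 ?mulr_ge0 ?addr_ge0 ?(ltW kappa0) //.
    apply: le_trans (eucl_dist_triangle _ (x k) _) _; rewrite eucl_distC.
    have := dist_extrap k; have := d_ge0 k.+1; move: wle; rewrite /r; lra.
  rewrite exprMn ler_wpM2l ?sqr_ge0 // /r.
  have := sqr_ge0 (d k - d k.+1); lra.
have := proxgrad_descent (xS k) (stationary_fin_num sw).
rewrite wz -/(y k) => h2.
have := mulr_ge0 (ltW L0) (sqr_ge0 (eucl_norm (w k - x k.+1))).
have := mulr_ge0 (ltW L0) (sqr_ge0 (d k)).
have := mulr_ge0 (ltW L0) (sqr_ge0 (d k.+1)).
have := ler_wpM2l (ltW Ll0) h1 => h3 h4 h5 h6.
have h7 : E k.+1 - zeta <= C * (d k ^+ 2 + d k.+1 ^+ 2) by rewrite /E /C; lra.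
have h8 : c * (d k ^+ 2 + d k.+1 ^+ 2) <= E k - E k.+2.
  have := energy_decrease k; have := energy_decrease k.+1; lra.
have : C / c * (c * (d k ^+ 2 + d k.+1 ^+ 2)) <= C / c * (E k - E k.+2).
  by rewrite ler_wpM2l // divr_ge0 // ltW.
rewrite mulrA divfK ?gt_eqF // => h9.
have := E_noninc (leqnSn k.+1); lra.
Qed.

Lemma proxgrad_linear_convergence : exists (s : 'rV[R]_n) (zeta M theta : R),
  [/\ stationary s, 0 <= M, 0 <= theta < 1,
      forall k, eucl_norm (x k - s) <= M * theta ^+ k &
      forall k, `|objective (x k) - zeta| <= M * theta ^+ k].
Proof.
have [kappa [zeta [N [w [kappa0 hw]]]]] := near_stationary_level.
have [Elb [A A0 two]] := energy_two_step kappa0 hw.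
(* The two-step inequality contracts E - zeta by A/(1+A), hence q per step; d_k is of the order of
   the root of E_k - zeta and decays at the rate sqrt q. *)
pose q := Num.sqrt (A / (1 + A)).
have A1 : 0 < 1 + A by rewrite addr_gt0.
have q2 : q ^+ 2 = A / (1 + A) by rewrite sqr_sqrtr // divr_ge0 // ltW.
have q0 : 0 < q by rewrite sqrtr_gt0 divr_gt0.
have q1 : q < 1.
  rewrite -(ltr_pXn2r (n := 2)) ?nnegrE ?(ltW q0) // q2 expr1n ltr_pdivrMr //.
  by rewrite mul1r ltrDr.
pose theta := Num.sqrt q.
have theta2 : theta ^+ 2 = q by rewrite sqr_sqrtr // ltW.
have theta0 : 0 < theta by rewrite sqrtr_gt0.
have theta1 : theta < 1.
  by rewrite -(ltr_pXn2r (n := 2)) ?nnegrE ?(ltW theta0) // theta2 expr1n.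
have qtheta k : q ^+ k = (theta ^+ k) ^+ 2 by rewrite -theta2 exprAC.
have [] := @two_step_decay _ (fun k => E k - zeta) q N.
- by rewrite q0.
- by move=> k; rewrite subr_ge0.
- by move=> k; rewrite lerB // E_noninc.
- move=> k Nk; rewrite q2 mulrAC ler_pdivlMr //; have := two k Nk; lra.
move=> M M0 eM.
pose D := Num.sqrt (M / c).
have D0 : 0 <= D by rewrite sqrtr_ge0.
have D2 : D ^+ 2 = M / c by rewrite sqr_sqrtr // divr_ge0 // ltW.
have dle k : d k <= D * theta ^+ k.
  rewrite -(ler_pXn2r (n := 2)) ?nnegrE ?mulr_ge0 ?exprn_ge0 ?(ltW theta0) //.
  rewrite exprMn D2 -qtheta mulrAC ler_pdivlMr // mulrC.
  have := eM k; have := energy_decrease k; have := Elb k.+1; lra.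
have thS k : theta ^+ k.+1 <= theta ^+ k.
  by rewrite ler_wiXn2l ?(ltW theta0) ?(ltW theta1).
have tht k : 0 <= theta ^+ k by rewrite exprn_ge0 // ltW.
(* Sum of the geometric series that bounds the remaining path length. *)
pose B := D / (1 - theta).
have omt : 0 < 1 - theta by rewrite subr_gt0.
have B0 : 0 <= B by rewrite divr_ge0 // ltW.
have BD : B - B * theta = D by rewrite -[X in X - _]mulr1 -mulrBr divfK ?gt_eqF.
have theta01 : 0 <= theta < 1 by rewrite theta1 ltW.
have [] := @rated_cauchy_vec _ _ x (fun k => B * theta ^+ k).
- exact: vanishing_geometric.
(* The sharper bound with theta^i - theta^j telescopes, so induction on j - i goes through. *)
- move=> i j ij; apply: le_trans (_ : B * (theta ^+ i - theta ^+ j) <= _); last first.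
    by rewrite ler_wpM2l // lerBlDr lerDl.
  move: ij => /subnK <-; elim: (j - i)%N => [|k IH].
    by rewrite !subrr eucl_norm0 mulr0.
  rewrite addSn; set e := (k + i)%N in IH *.
  apply: le_trans (eucl_dist_triangle _ (x e) _) _; rewrite (eucl_distC (x e)).
  have := dle e.+1; rewrite {1}/d /= => h.
  have : D * theta ^+ e = B * theta ^+ e - B * theta ^+ e.+1 by rewrite exprS -BD; ring.
  have := ler_wpM2l D0 (thS e); lra.
move=> s xs.
pose M' := B + 2 * kappa * D + M + L / 2 * D ^+ 2.
have kD : 0 <= 2 * kappa * D by rewrite !mulr_ge0 // ltW.
have LD : 0 <= L / 2 * D ^+ 2 by rewrite mulr_ge0 ?sqr_ge0 // divr_ge0 // ltW.
have M'0 : 0 <= M' by rewrite !addr_ge0.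
exists s, zeta, M', theta; split=> //.
(* The points w_j also converge to s, as |x_j - w_j| <= kappa r_j <= 2 kappa D theta^j; the shift by
   N skips the indices where w is unspecified. *)
- pose rr k := (2 * kappa * D + B) * theta ^+ k.
  have rr0 : vanishing rr by apply: vanishing_geometric => //; rewrite addr_ge0.
  apply: (@stationary_limit (fun k => w (N + k)%N) (fun k => rr (N + k)%N) zeta).
  + exact: vanishing_shift.
  + move=> k; set j := (N + k)%N; have [_ wle _] := hw j (leq_addr _ _).
    apply: le_trans (eucl_dist_triangle _ (x j) _) _; rewrite eucl_distC.
    have rj : r j <= 2 * (D * theta ^+ j).
      have := dle j; have := dle j.+1; have := ler_wpM2l D0 (thS j); rewrite /r; lra.
    have := ler_wpM2l (ltW kappa0) rj; have := xs j; rewrite /rr; lra.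
  + by move=> k; have [] := hw _ (leq_addr k N).
  + by move=> k; have [] := hw _ (leq_addr k N).
- move=> k; apply: le_trans (xs k) _; rewrite ler_wpM2r // /M'; lra.
move=> k; have qt : q ^+ k <= theta ^+ k.
  by rewrite qtheta expr2 ler_piMl // exprn_ile1 // ltW.
have Mq : M * q ^+ k <= M * theta ^+ k by rewrite ler_wpM2l.
have Lq : L / 2 * d k ^+ 2 <= L / 2 * D ^+ 2 * theta ^+ k.
  rewrite -[leRHS]mulrA ler_wpM2l ?divr_ge0 ?(ltW L0) //.
  apply: (@le_trans _ _ ((D * theta ^+ k) ^+ 2)).
    by rewrite ler_pXn2r ?nnegrE ?mulr_ge0.
  by rewrite exprMn -qtheta ler_wpM2l ?sqr_ge0.
have Bt := mulr_ge0 B0 (tht k); have kDt := mulr_ge0 kD (tht k).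
have Mt := mulr_ge0 M0 (tht k); have LDt := mulr_ge0 LD (tht k).
have dk : 0 <= L / 2 * d k ^+ 2 by rewrite mulr_ge0 ?sqr_ge0 // divr_ge0 // ltW.
(* F(x_k) lies between E_k - L/2 d_k^2 and E_k, and E_k >= zeta. *)
rewrite ler_norml /M'; apply/andP; split.
  by have := Elb k; rewrite /E; lra.
by have := eM k; rewrite /E; lra.
Qed.

End ProximalGradient.

Unset Implicit Arguments.
Set Strict Implicit.

Theorem theorem3p7 (R : realType) (n : nat)
  (g : 'rV[R]_n -> \bar R) (f1 f2 : 'rV[R]_n -> R)
  (gf1 gf2 : 'rV[R]_n -> 'rV[R]_n) (L l : R)
  (x : nat -> 'rV[R]_n) (beta : nat -> R) :
  proper_fun g -> convex_efun g -> closed_fun g ->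
  convex_fun f1 -> convex_fun f2 ->
  is_gradient f1 gf1 -> is_gradient f2 gf2 ->
  0 < L -> 0 <= l -> l <= L ->
  lipschitz_mod gf1 L -> lipschitz_mod gf2 l ->
  let f := fun z => f1 z - f2 z in
  let gf := fun z => gf1 z - gf2 z in
  let F := fun z => ((f z)%:E + g z)%E in
  let infF := ereal_inf (range F) in
  let X := [set z | exists v, subgrad g z v /\ gf z + v = 0] in
  let proxstep := fun z p : 'rV[R]_n => is_prox (scale_efun L^-1 g) (z - L^-1 *: gf z) p in
  (-oo < infF)%E -> (exists xs, F xs = infF) ->
  (* (a) error bound *)
  (forall xi : R, (infF <= xi%:E)%E ->
     exists eps tau : R, [/\ 0 < eps, 0 < tau &
       forall z p : 'rV[R]_n, proxstep z p -> eucl_norm (p - z) < eps -> (F z <= xi%:E)%E ->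
         (dist_to z X <= (tau * eucl_norm (p - z))%:E)%E]) ->
  (* (b) separation of stationary values *)
  (exists2 del : R, 0 < del &
     forall z w : 'rV[R]_n, X z -> X w -> F z <> F w -> del <= eucl_norm (z - w)) ->
  (* Algorithm 1 *)
  (g (x 0%N) < +oo)%E ->
  (forall k, 0 <= beta k <= Num.sqrt (L / (L + l))) ->
  (exists2 b : R, b < Num.sqrt (L / (L + l)) & forall k, beta k <= b) ->
  (forall k, proxstep (x k + beta k *: (x k - x k.-1)) (x k.+1)) ->
  (exists2 xs, X xs & Rlinear_vec x xs) /\
  (exists Fs : R, (forall k, F (x k) \is a fin_num) /\
                  Rlinear_real (fun k => fine (F (x k))) Fs).
Proof.
move=> pg cg lg cf1 cf2 df1 df2 L0 l0 lL lip1 lip2 f gf F infF X proxstep.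
move=> infF_lb _ eb sep x0 beta_range [b bL beta_le] xS.
have Ll0 : 0 < L + l by rewrite ltr_wpDr.
have f_upper u z : f z <= f u + dotv (gf u) (z - u) + L / 2 * eucl_norm (z - u) ^+ 2.
  have := convex_descent cf1 df1 (ltW L0) lip1 u z.
  have := convex_gradient_le cf2 df2 u z.
  rewrite /f /gf (dotvDl (gf1 u)) dotvNl; lra.
have f_lower u z : f u + dotv (gf u) (z - u) - l / 2 * eucl_norm (z - u) ^+ 2 <= f z.
  have := convex_descent cf2 df2 l0 lip2 u z.
  have := convex_gradient_le cf1 df1 u z.
  rewrite /f /gf (dotvDl (gf1 u)) dotvNl; lra.
have gf_lip : lipschitz_mod gf (L + l).
  move=> u v; have -> : gf u - gf v = (gf1 u - gf1 v) - (gf2 u - gf2 v).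
    by rewrite /gf !opprD addrACA.
  apply: le_trans (eucl_normD _ _) _; rewrite eucl_normN mulrDl.
  exact: lerD (lip1 _ _) (lip2 _ _).
have x0_fin := proper_fin_num pg x0.
have FE z : g z \is a fin_num -> F z = (objective g f z)%:E.
  by move=> zf; rewrite /F -{1}(fineK zf).
have infF_le z : (infF <= F z)%E by apply: ereal_inf_lbound; exists z.
have infF_fin : infF \is a fin_num.
  have := infF_le (x 0%N); rewrite (FE _ x0_fin).
  by move: infF_lb; case: (infF).
have beta_bound k : 0 <= beta k <= b.
  by have /andP[-> _] := beta_range k; rewrite beta_le.
have b0 : 0 <= b by have /andP[h1 h2] := beta_bound 0%N; exact: le_trans h1 h2.
have b_small : (L + l) * b ^+ 2 < L.
  rewrite mulrC -ltr_pdivlMr // -[ltRHS]sqr_sqrtr ?divr_ge0 ?(ltW L0) ?(ltW Ll0) //.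
  by rewrite ltr_pXn2r ?nnegrE ?sqrtr_ge0.
have x_fin k : g (x k) \is a fin_num := iterate_fin_num pg L0 x0_fin xS k.
have lb k : fine infF <= objective g f (x k).
  by rewrite -lee_fin fineK // -FE.
have [s [zeta [M [theta [s_st M0 theta01 xM FM]]]]] :
  exists (s : 'rV[R]_n) (zeta M theta : R),
  [/\ stationary g gf s, 0 <= M, 0 <= theta < 1,
      forall k, eucl_norm (x k - s) <= M * theta ^+ k &
      forall k, `|objective g f (x k) - zeta| <= M * theta ^+ k].
  apply: (proxgrad_linear_convergence pg cg lg L0 l0 lL f_upper f_lower gf_lip
            x0_fin beta_bound b_small xS lb).
    have [|eps [tau [eps0 tau0 h]]] := eb (objective g f (x 0%N)).
      by rewrite -FE.
    (* Doubling tau makes the distance bound strict, so some w in X realizes it. This fails for a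
       zero residual, but then z is a fixed point and itself stationary. *)
    exists eps, (2 * tau); split=> [//||z p zp pz zf zle]; first by rewrite mulr_gt0.
    have [p0|p0] := eqVneq (eucl_norm (p - z)) 0.
      move/eucl_norm0_eq0/eqP: (p0); rewrite subr_eq0 => /eqP pE.
      exists z; last by rewrite subrr eucl_norm0 p0 mulr0.
      by apply: (proxgrad_fix_stationary pg cg L0); rewrite pE in zp.
    have pp : 0 < eucl_norm (p - z) by rewrite lt_def p0 eucl_norm_ge0.
    have := h z p zp pz; rewrite (FE _ zf) lee_fin => /(_ zle) dle.
    have : (dist_to z X < (2 * tau * eucl_norm (p - z))%:E)%E.
      apply: le_lt_trans dle _; rewrite lte_fin -mulrA.
      by have := mulr_gt0 tau0 pp; lra.
    move=> /ereal_inf_lt [_ [w Xw <-]]; rewrite lte_fin => /ltW wle.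
    by exists w.
  have [del del0 h] := sep; exists del => // z w sz sw ne.
  apply: h => //; rewrite (FE _ (stationary_fin_num sz)) (FE _ (stationary_fin_num sw)).
  by move=> [].
split; first by exists s => //; apply: limn_esup_root_lt1 theta01 M0 xM => k; exact: eucl_norm_ge0.
exists zeta; split=> [k|]; first by rewrite FE.
apply: limn_esup_root_lt1 theta01 M0 _ => k; first exact: normr_ge0.
by rewrite FE //=.
Qed.
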